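(* Let $H$ be a bipartite graph with no vertex of degree zero or one, with vertex set $S\uplus T$, $S=\{1,\dots,n\}$, $T=\{n+1,\dots,n+m\}$. Then the matching map $\psi:\mathcal{V}(H)\to\mathcal{M}(H)$ is well defined (i.e., $\psi(\mathbf{a})$ is a matching of $W(H)$ for every clique vector $\mathbf{a}$) and is a bijection.
   Context: Every edge of $H$ joins a vertex of $S$ to a vertex of $T$; $N_H(v)$ is the neighborhood of $v$. A clique vector is $\mathbf{a}=((a_v)_{v\in S\cup T},(a_{i,j})_{ij\in E(H)})$ with $a_v\in N_H(v)$ for every vertex $v$ and $a_{i,j}\in\{+,-\}$, where $a_{i,j}$ may equal $+$ only if $a_i=j$ and $a_j=i$ (otherwise $a_{i,j}=-$); here edges are written $ij$ with $i\in S$, $j\in T$. $\mathcal{V}(H)$ is the set of clique vectors. The almost-degree-whiskered graph $W(H)$ is obtained from $H$ by adding pendant vertices as follows: if $v$ has neighbors $v_1<v_2<\dots<v_k$ in $H$, then $v$ receives new neighbors $w_{v,v_2},\dots,w_{v,v_k}$ if $v\in S$, and $w_{v,v_1},\dots,w_{v,v_{k-1}}$ if $v\in T$, each new vertex adjacent only to $v$. $\mathcal{M}(H)$ is the set of matchings of $W(H)$ (including the empty one). The matching map $\psi$ sends $\mathbf{a}$ to the set of edges of $W(H)$ obtained by including: (1) for $i\in S$ with $a_i=j$ and $a_j\ne i$, the edge $iw_{i,j}$ if it exists; (2) for $j\in T$ with $a_j=i$ and $a_i\ne j$, the edge $jw_{j,i}$ if it exists; (3) for $a_i=j$, $a_j=i$,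 $a_{i,j}=-$, the edge $ij$; (4) for $a_i=j$, $a_j=i$, $a_{i,j}=+$, the edges $iw_{i,j}$ and $jw_{j,i}$, each only if it exists. *)

(* Defs.v *)
From mathcomp Require Import all_boot.

Set Implicit Arguments.
Unset Strict Implicit.
Unset Printing Implicit Defensive.

(* Vertices are numbered from 0 instead of 1: S = {0, ..., n - 1} and
   T = {n, ..., n + m - 1}. *)
Record bigraph (n m : nat) := Bigraph {
  adj :> rel 'I_(n + m);
  adj_sym : symmetric adj;
  adj_bip : forall u v, adj u v -> (u < n) != (v < n)
}.

Section BipartiteGraph.
Variables (n m : nat) (H : bigraph n m).

Notation V := 'I_(n + m).

Definition partS : {set V} := [set v : V | v < n].
Definition partT : {set V} := [set v : V | n <= v].

Definition nbr (v : V) : {set V} := [set u | adj H v u].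

(* Each edge ij occurs once, as the pair (i, j) with i in S and j in T. *)
Definition bedge :=
  {p : V * V | [&& p.1 \in partS, p.2 \in partT & adj H p.1 p.2]}.

Definition eS (e : bedge) : V := (val e).1.
Definition eT (e : bedge) : V := (val e).2.

(* The components (a_v)_v and (a_{i,j})_{ij}; the sign + is encoded by true and
   - by false. *)
Definition vec := ({ffun V -> V} * {ffun bedge -> bool})%type.

Definition is_clique_vector (a : vec) : bool :=
  [forall v, a.1 v \in nbr v] &&
  [forall e, a.2 e ==> (a.1 (eS e) == eT e) && (a.1 (eT e) == eS e)].

Definition clique_vector := {a : vec | is_clique_vector a}.

(* w_{v,u} exists iff u is a neighbor of v that is not the smallest one (for v
   in S), resp. not the largest one (for v in T). *)
Definition has_whisker (v u : V) : bool :=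
  (u \in nbr v) &&
  (if v \in partS then [exists u' in nbr v, u' < u]
   else [exists u' in nbr v, u < u']).

(* The pair (v, u) stands for the pendant vertex w_{v,u}. *)
Definition whisker := {p : V * V | has_whisker p.1 p.2}.

Definition wfoot (w : whisker) : V := (val w).1.
Definition wlabel (w : whisker) : V := (val w).2.

Definition wvertex := (V + whisker)%type.

Definition wadj : rel wvertex := fun x y =>
  match x, y with
  | inl u, inl v => adj H u v
  | inl u, inr w => wfoot w == u
  | inr w, inl u => wfoot w == u
  | inr _, inr _ => false
  end.

Definition wedges : {set {set wvertex}} :=
  [set [set p.1; p.2] | p : wvertex * wvertex & wadj p.1 p.2].

Definition is_matching (M : {set {set wvertex}}) : bool :=
  (M \subset wedges) && trivIset M.

Definition matching := {M : {set {set wvertex}} | is_matching M}.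

Definition base_edge (e : bedge) : {set wvertex} :=
  [set inl (eS e); inl (eT e)].
Definition pendant_edge (w : whisker) : {set wvertex} :=
  [set inl (wfoot w); inr w].

(* The four sets correspond, in order, to the four rules defining the matching
   map; "if it exists" is expressed by letting w range over the pendant vertices
   of W(H). *)
Definition psi (a : vec) : {set {set wvertex}} :=
  [set pendant_edge w | w : whisker &
     [&& wfoot w \in partS, a.1 (wfoot w) == wlabel w
       & a.1 (wlabel w) != wfoot w]]
  :|:
  [set pendant_edge w | w : whisker &
     [&& wfoot w \in partT, a.1 (wfoot w) == wlabel w
       & a.1 (wlabel w) != wfoot w]]
  :|:
  [set base_edge e | e : bedge &
     [&& a.1 (eS e) == eT e, a.1 (eT e) == eS e & ~~ a.2 e]]
  :|:
  \bigcup_(e : bedge | [&& a.1 (eS e) == eT e, a.1 (eT e) == eS e & a.2 e])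
     [set pendant_edge w | w : whisker &
        (val w == (eS e, eT e)) || (val w == (eT e, eS e))].

End BipartiteGraph.

(* Main.v *)
Require Import Defs.
From mathcomp Require Import all_boot.

(** A vertex [v] has exactly one neighbor that labels no whisker at [v] (its
    smallest neighbor if [v] is in S, its largest one if [v] is in T).  Hence
    the matching [psi a] determines [a]: if [v] is matched to [u] or to
    [w_{v,u}] then [a_v = u]; if [v] is unmatched then [a_v] must be the
    neighbor without whisker; and [a_{i,j}] is [+] exactly when [a_i = j],
    [a_j = i] and [ij] is not in the matching.  Read as a definition, this
    recipe assigns to every matching a clique vector that [psi] sends to it. *)

Set Implicit Arguments.
Unset Strict Implicit.
Unset Printing Implicit Defensive.

(** * Two-element sets and families of disjoint sets *)

Lemma set2_inj (T : finType) (x y z t : T) :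
  [set x; y] = [set z; t] -> (x = z /\ y = t) \/ (x = t /\ y = z).
Proof.
move=> E.
have: x \in [set z; t] by rewrite -E set21.
have: y \in [set z; t] by rewrite -E set22.
have: z \in [set x; y] by rewrite E set21.
have: t \in [set x; y] by rewrite E set22.
by rewrite !in_set2; do 4! case/orP=> /eqP ?; subst; auto.
Qed.

Lemma trivIset_eq (T : finType) (P : {set {set T}}) (A B : {set T}) (x : T) :
  trivIset P -> A \in P -> B \in P -> x \in A -> x \in B -> A = B.
Proof.
move/trivIsetP=> tiP PA PB Ax Bx; apply/eqP/negPn/negP => /(tiP _ _ PA PB).
by move/disjoint_setI0/setP/(_ x); rewrite !inE Ax Bx.
Qed.

Section MatchingMap.
Variables (n m : nat) (H : bigraph n m).
Notation V := 'I_(n + m).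
Implicit Types (u v : V) (w : whisker H) (e : bedge H) (a b : vec H).
Implicit Types (X Y : {set wvertex H}) (N : {set {set wvertex H}}).

(** * Edges of $H$ and of $W(H)$ *)

Lemma adj_bedge v u :
  adj H v u -> exists e, val e = (v, u) \/ val e = (u, v).
Proof.
move=> vu; have := adj_bip vu.
(* Bipartiteness leaves two cases. A [bedge] lists its endpoint in $S$ first, whence the two
   possible orientations. *)
case: (ltnP v n) => vn; case: (ltnP u n) => un //= _.
  have p : [&& (v, u).1 \in partS n m, (v, u).2 \in partT n m
             & adj H (v, u).1 (v, u).2] by rewrite !inE vn un.
  by exists (Sub (v, u) p); left; rewrite SubK.
have p : [&& (u, v).1 \in partS n m, (u, v).2 \in partT n m
           & adj H (u, v).1 (u, v).2] by rewrite !inE vn un /= adj_sym.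
by exists (Sub (u, v) p); right; rewrite SubK.
Qed.

Lemma bedge_adj e : adj H (eS e) (eT e).
Proof. by case: e => [[i j] p]; case/and3P: (p). Qed.

Lemma in_pendant_edge w v : (inl v \in pendant_edge w) = (v == wfoot w).
Proof. by rewrite !inE orbF. Qed.

Lemma pendant_edge_inj : injective (@pendant_edge n m H).
Proof. by move=> w w' /set2_inj[[_ [->]]|[]]. Qed.

Lemma inl_pair_neq_pendant_edge u v w : [set inl u; inl v] <> pendant_edge w.
Proof. by case/set2_inj => [[]|[]]. Qed.

(** The unordered pair determines its orientation: swapped endpoints would place one vertex in both
    $S$ and $T$. *)
Lemma base_edge_inj : injective (@base_edge n m H).
Proof.
move=> e e' /set2_inj[[[E1] [E2]]|[[E1] [E2]]]; apply: val_inj.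
  by rewrite [val e]surjective_pairing [val e']surjective_pairing; congr (_, _).
have /and3P[eS_S _ _] := valP e; have /and3P[_ eT_T _] := valP e'.
by move: eS_S eT_T; rewrite -/(eS e) -/(eT e') E1 !inE ltnNge => /negPf->.
Qed.

Lemma pendant_edge_wedges w : pendant_edge w \in wedges H.
Proof.
by apply/imsetP; exists (inl (wfoot w), inr w); rewrite // inE /= eqxx.
Qed.

Lemma wedgesP X :
  X \in wedges H ->
  (exists w, X = pendant_edge w) \/ (exists e, X = base_edge e).
Proof.
case/imsetP=> [[[u|w] [v|w']]]; rewrite inE //=.
- case/adj_bedge=> e He ->; right; exists e; rewrite /base_edge /eS /eT.
  by case: He => -> //=; rewrite setUC.
- by move/eqP=> <- ->; left; exists w'.
- by move/eqP=> <- ->; left; exists w; rewrite setUC.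
Qed.

(** Symmetric in [v] and [u], so that later arguments need not ask on which side the foot of a
    whisker lies. *)
Definition positive_pair a v u : bool :=
  [exists e, ((val e == (v, u)) || (val e == (u, v))) && a.2 e].

Lemma positive_pair_edge a e w :
  val w = (eS e, eT e) \/ val w = (eT e, eS e) ->
  positive_pair a (wfoot w) (wlabel w) -> a.2 e.
Proof.
rewrite /wfoot /wlabel => Hw /existsP[e' /andP[He' ae']].
suff -> : e = e' by [].
apply: base_edge_inj; rewrite /base_edge {2}/eS {2}/eT.
by case: Hw He' => -> /= /orP[]/eqP-> //=; rewrite setUC.
Qed.

(** * The image of a clique vector is a matching *)

Section CliqueVector.
Variable a : vec H.
Hypothesis Ha : is_clique_vector a.

Lemma clique_adj v : adj H v (a.1 v).
Proof. by case/andP: Ha => /forallP/(_ v); rewrite inE. Qed.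

Lemma clique_sign e : a.2 e -> a.1 (eS e) = eT e /\ a.1 (eT e) = eS e.
Proof. by case/andP: Ha => _ /forallP/(_ e)/implyP K /K/andP[/eqP-> /eqP->]. Qed.

(** Rules (1), (2) and (4) merge into one condition on the pendant edge at $w_{v,u}$: $a_v = u$, and
    the sign is $+$ in case also $a_u = v$. *)
Lemma psiP X :
  reflect
    ((exists2 w, X = pendant_edge w &
        a.1 (wfoot w) = wlabel w /\
        (a.1 (wlabel w) = wfoot w -> positive_pair a (wfoot w) (wlabel w))) \/
     (exists2 e, X = base_edge e &
        [/\ a.1 (eS e) = eT e, a.1 (eT e) = eS e & ~~ a.2 e]))
    (X \in psi a).
Proof.
apply: (iffP idP).
  rewrite 3!in_setU -!orbA; case/or4P.
  - case/imsetP=> w; rewrite inE => /and3P[_ /eqP aw /eqP naw] ->.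
    by left; exists w.
  - case/imsetP=> w; rewrite inE => /and3P[_ /eqP aw /eqP naw] ->.
    by left; exists w.
  - case/imsetP=> e; rewrite inE => /and3P[/eqP e1 /eqP e2 e3] ->.
    by right; exists e.
  - case/bigcupP=> e /and3P[/eqP e1 /eqP e2 e3] /imsetP[w]; rewrite inE => Hw ->.
    left; exists w => //; rewrite /wfoot /wlabel; case/orP: Hw => /eqP Hw.
      rewrite Hw /=; split=> // _; apply/existsP; exists e.
      by rewrite e3 -surjective_pairing eqxx.
    rewrite Hw /=; split=> // _; apply/existsP; exists e.
    by rewrite e3 -(surjective_pairing (val e)) eqxx orbT.
rewrite 3!in_setU -!orbA; case.
  (* A mutual choice falls under rule (4); otherwise the side of the foot selects rule (1) or
     (2). *)
  case=> w -> [aw Hw]; case: (altP (a.1 (wlabel w) =P wfoot w)) => [law|naw].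
    have /existsP[e /andP[He ae]] := Hw law.
    suff -> : pendant_edge w \in \bigcup_(e : bedge H | [&& a.1 (eS e) == eT e,
         a.1 (eT e) == eS e & a.2 e]) [set pendant_edge w | w : whisker H &
        (val w == (eS e, eT e)) || (val w == (eT e, eS e))] by rewrite !orbT.
    have [/eqP e1 /eqP e2] := clique_sign ae.
    apply/bigcupP; exists e; first by rewrite e1 e2.
    apply/imsetP; exists w => //; rewrite inE /eS /eT.
    move: He; rewrite /wfoot /wlabel.
    by case/orP=> /eqP->; rewrite /= -(surjective_pairing (val w)) eqxx ?orbT.
  case: (ltnP (wfoot w) n) => wn; apply/or4P; [apply: Or41 | apply: Or42];
    by apply/imsetP; exists w; rewrite // !inE wn aw eqxx.
case=> e -> [e1 e2 e3]; apply/or4P; apply: Or43.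
by apply/imsetP; exists e; rewrite // inE e1 e2 !eqxx.
Qed.

Lemma base_edge_psi e :
  (base_edge e \in psi a) =
  [&& a.1 (eS e) == eT e, a.1 (eT e) == eS e & ~~ a.2 e].
Proof.
apply/psiP/and3P => [[[w /inl_pair_neq_pendant_edge[]]|]|].
  by case=> e' /base_edge_inj<- [/eqP ? /eqP ?].
by case=> /eqP ? /eqP ? ?; right; exists e.
Qed.

Lemma psi_wedges : psi a \subset wedges H.
Proof.
apply/subsetP=> X /psiP[[w -> _]|[e -> _]]; first exact: pendant_edge_wedges.
by apply/imsetP; exists (inl (eS e), inl (eT e)); rewrite // inE /= bedge_adj.
Qed.

Lemma pendant_edge_psi w : pendant_edge w \in psi a ->
  a.1 (wfoot w) = wlabel w /\
  (a.1 (wlabel w) = wfoot w -> positive_pair a (wfoot w) (wlabel w)).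
Proof.
by case/psiP=> [[w' /pendant_edge_inj<-]|[e /esym/inl_pair_neq_pendant_edge]].
Qed.

(** If the base edge contains the foot of [w], then [w] is labelled by its other endpoint. The
    choice is then mutual, so the pendant edge demands sign $+$ and the base edge sign $-$. *)
Lemma pendant_base_disjoint w e v :
  pendant_edge w \in psi a -> base_edge e \in psi a ->
  inl v \in pendant_edge w -> inl v \notin base_edge e.
Proof.
case/pendant_edge_psi=> aw Hw; rewrite base_edge_psi => /and3P[/eqP e1 /eqP e2 e3].
rewrite in_pendant_edge => /eqP->; apply: contra e3.
have Ew : val w = (wfoot w, wlabel w) := surjective_pairing _.
rewrite !inE => /orP[] /eqP[E].
  have L : wlabel w = eT e by rewrite -aw E.
  apply: (@positive_pair_edge a e w); first by left; rewrite Ew E L.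
  by apply: Hw; rewrite L E.
have L : wlabel w = eS e by rewrite -aw E.
apply: (@positive_pair_edge a e w); first by right; rewrite Ew E L.
by apply: Hw; rewrite L E.
Qed.

(** Every edge of [psi a] at [v] is governed by $a_v$: two pendant edges share their label, two base
    edges share their other endpoint, and the signs exclude one of each. *)
Lemma psi_edge_eq X Y v :
  X \in psi a -> Y \in psi a -> inl v \in X -> inl v \in Y -> X = Y.
Proof.
move=> aX aY; have [[w EX]|[e EX]] := wedgesP (subsetP psi_wedges _ aX);
  have [[w' EY]|[e' EY]] := wedgesP (subsetP psi_wedges _ aY); subst X Y.
- rewrite !in_pendant_edge => /eqP-> /eqP E; congr pendant_edge.
  have [aw _] := pendant_edge_psi aX; have [aw' _] := pendant_edge_psi aY.
  apply: val_inj; rewrite [val w]surjective_pairing [val w']surjective_pairing.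
  by congr (_, _) => //; rewrite -/(wlabel w) -aw E aw'.
- by move=> /(pendant_base_disjoint aX aY)/negPf->.
- by move=> K /(pendant_base_disjoint aY aX)/negP.
move: aX aY; rewrite !base_edge_psi.
case/and3P=> /eqP e1 /eqP e2 _ /and3P[/eqP f1 /eqP f2 _].
rewrite /base_edge !inE => /orP[]/eqP[->] /orP[]/eqP[E].
- by rewrite -e1 E f1.
- by rewrite -e1 E f2 setUC.
- by rewrite -e2 E f1 setUC.
- by rewrite -e2 E f2.
Qed.

Lemma psi_matching : is_matching (psi a).
Proof.
rewrite /is_matching psi_wedges; apply/trivIsetP=> X Y aX aY.
apply: contraR; rewrite -setI_eq0 => /set0Pn[[v|w]]; rewrite inE => /andP[Xx Yx].
  by apply/eqP; apply: psi_edge_eq aX aY Xx Yx.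
(* A pendant vertex lies on a single edge of $W(H)$. *)
have K Z : Z \in psi a -> inr w \in Z -> Z = pendant_edge w.
  move=> aZ; have [[w' ->]|[e ->]] := wedgesP (subsetP psi_wedges _ aZ).
    by rewrite in_set2 /= => /eqP[->].
  by rewrite in_set2.
by rewrite (K X aX Xx) (K Y aY Yx) eqxx.
Qed.

End CliqueVector.

(** * Reading a clique vector off its matching *)

(* [v] is matched by [N] to [u] itself or to the pendant vertex [w_{v,u}]. *)
Definition points_to N v u : bool :=
  [exists w, (val w == (v, u)) && (pendant_edge w \in N)]
  || ([set inl v; inl u] \in N).

Lemma pendant_points_to N w :
  pendant_edge w \in N -> points_to N (wfoot w) (wlabel w).
Proof.
move=> Nw; apply/orP; left; apply/existsP; exists w.
by rewrite Nw [val w]surjective_pairing eqxx.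
Qed.

Lemma base_points_to N e :
  base_edge e \in N -> points_to N (eS e) (eT e) /\ points_to N (eT e) (eS e).
Proof. by move=> Ne; split; apply/orP; right => //; rewrite setUC. Qed.

Lemma points_to_psi a v u :
  is_clique_vector a -> points_to (psi a) v u -> a.1 v = u.
Proof.
move=> Ha /orP[/existsP[w /andP[/eqP Ew]]|].
  by case/(pendant_edge_psi Ha); rewrite /wfoot /wlabel Ew.
case/(psiP Ha)=> [[w /inl_pair_neq_pendant_edge//]|[e /set2_inj E [e1 e2 _]]].
by case: E => [[[->] [->]]|[[->] [->]]].
Qed.

(** Since $w_{v,a_v}$ exists, its pendant edge is in [psi a] unless [v] and $a_v$ choose each other
    with sign $-$; in that case rule (3) supplies the base edge. *)
Lemma whisker_points_to a v :
  is_clique_vector a -> has_whisker H v (a.1 v) -> points_to (psi a) v (a.1 v).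
Proof.
move=> Ha hw; set w : whisker H := Sub (v, a.1 v) hw.
have Ew : val w = (v, a.1 v) by [].
have [Pw|nPw] := boolP (pendant_edge w \in psi a).
  exact: pendant_points_to Pw.
have [e He] := adj_bedge (clique_adj Ha v).
have Ew' : val w = (eS e, eT e) \/ val w = (eT e, eS e).
  by rewrite /eS /eT Ew; case: He => ->; [left | right].
have [mu|nmu] := eqVneq (a.1 (a.1 v)) v; last first.
  case/negP: nPw; apply/psiP => //; left; exists w => //; split=> //.
  by rewrite /wlabel /wfoot Ew /= => K; rewrite K eqxx in nmu.
have [ae|nae] := boolP (a.2 e).
  case/negP: nPw; apply/psiP => //; left; exists w => //; split=> // _.
  apply/existsP; exists e; rewrite ae andbT /wfoot /wlabel Ew /=.
  by case: He => ->; rewrite eqxx ?orbT.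
have : base_edge e \in psi a.
  rewrite base_edge_psi // nae /eS /eT.
  by case: He => -> /=; rewrite mu !eqxx.
by case/base_points_to; rewrite /eS /eT; case: He => ->.
Qed.

(** * Neighbors that label no whisker *)

Lemma has_whisker_of_two v u u' :
  adj H v u -> adj H v u' -> u < u' -> has_whisker H v u || has_whisker H v u'.
Proof.
move=> vu vu' lt_uu'; rewrite /has_whisker !inE vu vu' /=.
(* For [v] in $S$ the larger neighbor is not the minimum; for [v] in $T$ the smaller one is not the
   maximum. *)
case: ifP => _; apply/orP; [right | left]; apply/existsP;
  by [exists u; rewrite inE vu | exists u'; rewrite inE vu'].
Qed.

Lemma no_whisker_uniq v u u' :
  adj H v u -> adj H v u' -> ~~ has_whisker H v u -> ~~ has_whisker H v u' ->
  u = u'.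
Proof.
move=> vu vu' /negPf nu /negPf nu'; apply: val_inj; case: (ltngtP u u') => //.
  by move/(has_whisker_of_two vu vu'); rewrite nu nu'.
by move/(has_whisker_of_two vu' vu); rewrite nu nu'.
Qed.

Lemma no_whisker_exists v u :
  adj H v u -> exists u', adj H v u' && ~~ has_whisker H v u'.
Proof.
move=> vu; have [vS|vT] := boolP (v \in partS n m).
  case: (@arg_minnP _ u (adj H v) (fun x => x) vu) => u' vu' min_u'.
  exists u'; rewrite vu' /has_whisker vS negb_and; apply/orP; right.
  by apply/existsPn=> x; rewrite inE negb_and -leqNgt -implybE; apply/implyP/min_u'.
case: (@arg_maxnP _ u (adj H v) (fun x => x) vu) => u' vu' max_u'.
exists u'; rewrite vu' /has_whisker (negPf vT) negb_and; apply/orP; right.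
by apply/existsPn=> x; rewrite inE negb_and -leqNgt -implybE; apply/implyP/max_u'.
Qed.

(** * Injectivity *)

Lemma psi_inj a b :
  is_clique_vector a -> is_clique_vector b -> psi a = psi b -> a = b.
Proof.
move=> Ha Hb E.
have E1 : a.1 = b.1.
  apply/ffunP=> v; have [aw|naw] := boolP (has_whisker H v (a.1 v)).
    by have := whisker_points_to Ha aw; rewrite E => /(points_to_psi Hb).
  have [bw|nbw] := boolP (has_whisker H v (b.1 v)).
    by have := whisker_points_to Hb bw; rewrite -E => /(points_to_psi Ha).
  (* Here both vectors choose at [v] a neighbor without whisker, and there is only one. *)
  exact: no_whisker_uniq (clique_adj Ha v) (clique_adj Hb v) naw nbw.
(* For a mutual choice, rule (3) puts the base edge into the image exactly when the sign is $-$;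
   without mutuality the sign is forced to be $-$. *)
have sign c : is_clique_vector c ->
    forall e, c.2 e = [&& c.1 (eS e) == eT e, c.1 (eT e) == eS e
                        & base_edge e \notin psi c].
  move=> Hc e; rewrite base_edge_psi //.
  case ce: (c.2 e); last by do 2 case: eqP.
  by have [-> ->] := clique_sign Hc ce; rewrite !eqxx.
rewrite [a]surjective_pairing [b]surjective_pairing E1; congr (_, _).
by apply/ffunP=> e; rewrite !sign // E E1.
Qed.

(** * Surjectivity: the clique vector of a given matching *)

Section InverseMap.
Hypothesis nbr_ex : forall v, exists u, adj H v u.
Variable N : {set {set wvertex H}}.
Hypothesis HN : is_matching N.

(** Both witnesses are edges of [N] containing [v], hence equal, and such an edge determines the
    vertex pointed to. *)
Lemma points_to_uniq v u u' : points_to N v u -> points_to N v u' -> u = u'.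
Proof.
have /andP[_ tiN] := HN.
have K x : points_to N v x -> exists2 X, X \in N & inl v \in X /\
    ((exists2 w, X = pendant_edge w & val w = (v, x)) \/ X = [set inl v; inl x]).
  case/orP=> [/existsP[w /andP[/eqP Ew Nw]]|Nx].
    exists (pendant_edge w) => //; split; last by left; exists w.
    by rewrite in_pendant_edge /wfoot Ew.
  by exists [set inl v; inl x] => //; split; [rewrite set21 | right].
case/K=> X NX [vX EX] /K[Y NY [vY EY]].
have XY := trivIset_eq tiN NX NY vX vY; rewrite {}XY in EX.
case: EX EY => [[w -> Ew]|->] [[w' + Ew']|].
- by move/pendant_edge_inj=> ww'; move: Ew; rewrite ww' Ew' => -[].
- by move/esym/inl_pair_neq_pendant_edge.
- by move/inl_pair_neq_pendant_edge.
- by case/set2_inj=> [[_ []]|[[<-] [->]]].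
Qed.

Lemma points_to_adj v u : points_to N v u -> adj H v u.
Proof.
have /andP[sN _] := HN; case/orP=> [/existsP[w /andP[/eqP Ew _]]|].
  by have /andP[] := valP w; rewrite Ew inE.
case/(subsetP sN)/wedgesP=> [[w /inl_pair_neq_pendant_edge//]|[e /set2_inj]].
by case=> -[[->] [->]]; [|rewrite adj_sym]; apply: bedge_adj.
Qed.

(** The fallback [v] is never returned: as [v] has a neighbor, it has one without whisker. *)
Definition default_nbr v : V :=
  odflt v [pick u | adj H v u && ~~ has_whisker H v u].

Lemma default_nbrP v :
  adj H v (default_nbr v) && ~~ has_whisker H v (default_nbr v).
Proof.
rewrite /default_nbr; case: pickP => [//|nex].
have [u vu] := nbr_ex v; have [u'] := no_whisker_exists vu.
by rewrite nex.
Qed.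

Definition vector_of_matching : vec H :=
  let f := [ffun v => odflt (default_nbr v) [pick u | points_to N v u]] in
  (f, [ffun e => [&& f (eS e) == eT e, f (eT e) == eS e & base_edge e \notin N]]).

Let a := vector_of_matching.

Lemma vector_points_to v u : points_to N v u -> a.1 v = u.
Proof.
move=> vu; rewrite ffunE; case: pickP => [u' vu'|/(_ u)]; last by rewrite vu.
exact: points_to_uniq vu' vu.
Qed.

(** A vertex unmatched in [N] receives its neighbor without whisker, so [psi] cannot create a
    pendant edge there. *)
Lemma vector_has_whisker v : has_whisker H v (a.1 v) -> points_to N v (a.1 v).
Proof.
rewrite ffunE; case: pickP => //= _ hw.
by have := default_nbrP v; rewrite hw andbF.
Qed.

Lemma vector_sign e :
  a.2 e = [&& a.1 (eS e) == eT e, a.1 (eT e) == eS e & base_edge e \notin N].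
Proof. by rewrite ffunE. Qed.

Lemma vector_of_matching_clique : is_clique_vector a.
Proof.
apply/andP; split.
  apply/forallP=> v; rewrite inE ffunE; case: pickP => [u /points_to_adj//|_].
  by have /andP[] := default_nbrP v.
by apply/forallP=> e; rewrite vector_sign; apply/implyP=> /and3P[-> ->].
Qed.

Lemma psi_vector_of_matching : psi a = N.
Proof.
have Ha := vector_of_matching_clique; have /andP[sN tiN] := HN.
apply/setP=> X; apply/idP/idP.
  case/(psiP Ha)=> [[w -> [aw Hw]]|[e -> [e1 e2]]]; last first.
    by rewrite vector_sign e1 e2 !eqxx negbK.
  have Ew : val w = (wfoot w, wlabel w) := surjective_pairing _.
  (* The whisker [w] exists, so [N] matches its foot, through either [w] itself or the base edge. *)
  have := @vector_has_whisker (wfoot w); rewrite aw => /(_ (valP w)).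
  case/orP=> [/existsP[w' /andP[/eqP Ew' Nw']]|Nwu].
    by have <- : w' = w by apply: val_inj; rewrite Ew' Ew.
  (* A base edge in [N] would make the choice mutual, forcing sign $+$; but [vector_of_matching]
     gives $+$ only to edges outside [N]. *)
  have /Hw/existsP[e /andP[He]] : a.1 (wlabel w) = wfoot w.
    by apply: vector_points_to; apply/orP; right; rewrite setUC.
  rewrite vector_sign => /and3P[_ _ /negP[]].
  by rewrite /base_edge /eS /eT; case/orP: He => /eqP->; rewrite // setUC.
move=> NX; have [[w EX]|[e EX]] := wedgesP (subsetP sN _ NX); subst X; last first.
  have [/vector_points_to e1 /vector_points_to e2] := base_points_to NX.
  by rewrite base_edge_psi // vector_sign e1 e2 NX !eqxx.
apply/psiP => //; left; exists w => //.
have aw := vector_points_to (pendant_points_to NX); split=> // law.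
have /andP[+ _] := valP w; rewrite inE => /adj_bedge[e He].
apply/existsP; exists e; apply/andP; split.
  by rewrite /wfoot /wlabel; case: He => ->; rewrite eqxx ?orbT.
rewrite vector_sign.
have Ee : base_edge e = [set inl (wfoot w); inl (wlabel w)].
  by rewrite /base_edge /eS /eT; case: He => -> //=; rewrite setUC.
apply/and3P; split.
- by rewrite /eS /eT; case: He => -> /=; apply/eqP.
- by rewrite /eS /eT; case: He => -> /=; apply/eqP.
(* Otherwise [N] would contain two distinct edges at the foot of [w]. *)
apply/negP; rewrite Ee => Ne.
apply: (@inl_pair_neq_pendant_edge (wfoot w) (wlabel w) w).
by apply: (trivIset_eq tiN Ne NX (x := inl (wfoot w))); rewrite set21.
Qed.

End InverseMap.

End MatchingMap.

Theorem theorem3p9 (n m : nat) (H : bigraph n m)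
    (Hdeg : forall v : 'I_(n + m), 1 < #|nbr H v|) :
  exists psi_wd : (forall a : clique_vector H, is_matching (psi (sval a))),
    bijective (fun a : clique_vector H =>
      exist (fun M => is_matching M) (psi (sval a)) (psi_wd a) : matching H).
Proof.
have nbr_ex v : exists u, adj H v u.
  have /card_gt0P[u] : 0 < #|nbr H v| by apply: leq_trans (Hdeg v).
  by rewrite inE => vu; exists u.
exists (fun a => psi_matching (svalP a)).
pose g (N : matching H) : clique_vector H :=
  exist (fun a => is_clique_vector a) _
    (vector_of_matching_clique nbr_ex (svalP N)).
exists g => [a|N]; apply: val_inj; last first.
  exact: (psi_vector_of_matching nbr_ex (svalP N)).
(* By injectivity, [g] is a left inverse as soon as the vector read off [psi a] has image
   [psi a]. *)
apply: psi_inj (svalP (g _)) (svalP a) _.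
exact: (psi_vector_of_matching nbr_ex (psi_matching (svalP a))).
Qed.
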